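(* Let $R$ be a Kähler algebraic curvature operator on a complex Euclidean vector space $(V,g,J)$ of complex dimension $m\geq2$. (1) If $R$ has $\frac{3}{2}(m^2-1)$-nonnegative (respectively, $\frac{3}{2}(m^2-1)$-nonpositive) curvature operator of the second kind, then $R$ has constant nonnegative (respectively, nonpositive) holomorphic sectional curvature. (2) If $R$ has $\alpha$-nonnegative (respectively, $\alpha$-nonpositive) curvature operator of the second kind for some $\alpha<\frac{3}{2}(m^2-1)$, then $R$ is flat, i.e. $R=0$.
   Context: A complex Euclidean vector space $(V,g,J)$ of complex dimension $m$ is a real inner product space $(V,g)$ of real dimension $2m$ with an endomorphism $J$ satisfying $J^2=-\operatorname{id}$ and $g(JX,JY)=g(X,Y)$. An algebraic curvature operator on $V$ is a 4-linear form $R$ on $V$ with $R(X,Y,Z,W)=-R(Y,X,Z,W)=-R(X,Y,W,Z)=R(Z,W,X,Y)$ and satisfying the first Bianchi identity $R(X,Y,Z,W)+R(Y,Z,X,W)+R(Z,X,Y,W)=0$. It is called Kähler if moreover $R(X,Y,Z,W)=R(X,Y,JZ,JW)$ for all $X,Y,Z,W\in V$. The sign convention is that $R(X,Y,X,Y)$ is the sectional curvature for orthonormal $X,Y$. Let $n=2m$, let $S^2_0(V)$ be the space of traceless symmetric two-tensors on $V$ with inner product $\langle A,B\rangle=\operatorname{tr}(A^TB)$, and $N=\dim S^2_0(V)=\frac{(n-1)(n+2)}{2}$. The curvature operator of the second kind of $R$ is the symmetric bilinear form on $S^2_0(V)$ given in an orthonormal basis of $V$ by $\mathring{R}(\varphi,\psi)=\sum_{i,j,k,l=1}^n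 R_{ijkl}\varphi_{il}\psi_{jk}$. For a real $\alpha\in[1,N]$, $R$ has $\alpha$-nonnegative curvature operator of the second kind if for every orthonormal basis $\{\varphi_i\}_{i=1}^N$ of $S^2_0(V)$, $$\sum_{i=1}^{\lfloor\alpha\rfloor}\mathring{R}(\varphi_i,\varphi_i)+(\alpha-\lfloor\alpha\rfloor)\mathring{R}(\varphi_{\lfloor\alpha\rfloor+1},\varphi_{\lfloor\alpha\rfloor+1})\geq0,$$ where the last term is absent when $\alpha$ is an integer; $R$ has $\alpha$-nonpositive curvature operator of the second kind if $-R$ has $\alpha$-nonnegative curvature operator of the second kind. $R$ has constant holomorphic sectional curvature $c$ if $R(X,JX,X,JX)=c$ for all unit $X\in V$. *)

(* Defs.v *)
From HB Require Import structures.
From mathcomp Require Import all_boot all_order all_algebra.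
From mathcomp Require Import reals.

Set Implicit Arguments.
Unset Strict Implicit.
Unset Printing Implicit Defensive.

Import Order.TTheory GRing.Theory Num.Theory.

Local Open Scope ring_scope.

(* k-linear forms are curried linear maps with values in R^o, so that          *)
(* phi X Y and Rm X Y Z W are ordinary applications, multilinearity is part of *)
(* the type, and the forms of each arity are a vectType over R.                *)
Notation tensor2 V := ('Hom(V, 'Hom(V, _^o))).
Notation tensor4 V := ('Hom(V, 'Hom(V, 'Hom(V, 'Hom(V, _^o))))).

Definition complex_euclidean (R : realType) (V : vectType R)
    (g : {dot V for idfun}) (J : 'End(V)) : Prop :=
  (forall X, J (J X) = - X) /\ (forall X Y, g (J X) (J Y) = g X Y).

Definition algebraic_curvature (R : realType) (V : vectType R)
    (Rm : tensor4 V) : Prop :=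
  [/\ forall X Y Z W, Rm X Y Z W = - Rm Y X Z W,
      forall X Y Z W, Rm X Y Z W = - Rm X Y W Z,
      forall X Y Z W, Rm X Y Z W = Rm Z W X Y &
      forall X Y Z W, Rm X Y Z W + Rm Y Z X W + Rm Z X Y W = 0].

Definition kahler_curvature (R : realType) (V : vectType R) (J : 'End(V))
    (Rm : tensor4 V) : Prop :=
  algebraic_curvature Rm /\
  forall X Y Z W, Rm X Y Z W = Rm X Y (J Z) (J W).

Definition orthonormal_basis (R : realType) (V : vectType R)
    (g : {dot V for idfun}) (e : (\dim {:V}).-tuple V) : bool :=
  basis_of {:V} e && orthonormal g e.

(* The definitions below that take a basis e of V are used for e orthonormal,  *)
(* and their values then do not depend on the choice of e.                     *)

Definition components (R : realType) (V : vectType R)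
    (e : (\dim {:V}).-tuple V) (phi : tensor2 V) : 'M[R]_(\dim {:V}) :=
  \matrix_(i, j) phi (tnth e i) (tnth e j).

Definition tensor_dot (R : realType) (V : vectType R)
    (e : (\dim {:V}).-tuple V) (A B : tensor2 V) : R :=
  \tr ((components e A)^T *m components e B).

Definition traceless_symmetric (R : realType) (V : vectType R)
    (e : (\dim {:V}).-tuple V) (phi : tensor2 V) : Prop :=
  (forall X Y, phi X Y = phi Y X) /\ \tr (components e phi) = 0.

Definition dim_S20 (R : realType) (V : vectType R) : nat :=
  ((\dim {:V}).-1 * (\dim {:V}).+2) %/ 2.

Definition orthonormal_basis_S20 (R : realType) (V : vectType R)
    (e : (\dim {:V}).-tuple V) (phi : (dim_S20 V).-tuple (tensor2 V)) : Prop :=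
  [/\ forall i, traceless_symmetric e (tnth phi i),
      forall i j, tensor_dot e (tnth phi i) (tnth phi j) = (i == j)%:R &
      forall psi, traceless_symmetric e psi -> psi \in <<phi>>%VS].

Definition second_kind (R : realType) (V : vectType R)
    (e : (\dim {:V}).-tuple V) (Rm : tensor4 V) (phi psi : tensor2 V) : R :=
  \sum_(i < \dim {:V}) \sum_(j < \dim {:V})
    \sum_(k < \dim {:V}) \sum_(l < \dim {:V})
      Rm (tnth e i) (tnth e j) (tnth e k) (tnth e l) *
      components e phi i l * components e psi j k.

(* Indices are shifted by one: phi`_k is the (k+1)-st tensor of the basis.     *)
(* When alpha is an integer the last term has coefficient 0 (for alpha = N,    *)
(* moreover, phi`_N is the default value 0), so it is absent.                  *)
Definition alpha_nonnegative (R : realType) (V : vectType R)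
    (g : {dot V for idfun}) (alpha : R) (Rm : tensor4 V) : Prop :=
  1 <= alpha <= (dim_S20 V)%:R /\
  forall (e : (\dim {:V}).-tuple V) (phi : (dim_S20 V).-tuple (tensor2 V)),
    orthonormal_basis g e -> orthonormal_basis_S20 e phi ->
    let k := Num.truncn alpha in
    0 <= \sum_(i < k) second_kind e Rm phi`_i phi`_i
         + (alpha - k%:R) * second_kind e Rm phi`_k phi`_k.

Definition alpha_nonpositive (R : realType) (V : vectType R)
    (g : {dot V for idfun}) (alpha : R) (Rm : tensor4 V) : Prop :=
  alpha_nonnegative g alpha (- Rm).

Definition constant_holomorphic_curvature (R : realType) (V : vectType R)
    (g : {dot V for idfun}) (J : 'End(V)) (Rm : tensor4 V) (c : R) : Prop :=
  forall X : V, g X X = 1 -> Rm X (J X) X (J X) = c.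

(* Main.v *)
Require Import Defs.
From HB Require Import structures.
From mathcomp Require Import all_boot all_order all_algebra.
From mathcomp Require Import reals ring lra zify.

(* In an orthonormal basis, split the traceless symmetric matrices into the    *)
(* part commuting with J, of dimension p = m^2 - 1, and the part anticommuting *)
(* with J, of dimension q = m(m+1). The trace of the curvature operator of the *)
(* second kind on a subspace is its contraction with the kernel of the         *)
(* orthogonal projector, and by the Bianchi identity and J-invariance it is a  *)
(* multiple of the scalar curvature: the traces are - (p/2) mu and q mu for    *)
(* the same mu. Averaging the partial sums of an adapted orthonormal basis     *)
(* over rotations of the two blocks gives exactly zero for alpha = 3p/2, hence *)
(* every partial sum vanishes, and exchanging basis elements shows that all    *)
(* diagonal values on the anticommuting part equal mu. One of them is the      *)
(* holomorphic sectional curvature of a given unit vector X, attained at       *)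
(* (X (x) X - JX (x) JX) / sqrt 2. The average over all rotations gives        *)
(* mu >= 0, and for alpha < 3p/2 the block average forces mu <= 0; then all    *)
(* diagonal values vanish, so the holomorphic sectional curvature is zero and  *)
(* polarization gives flatness.                                                *)

Set Implicit Arguments.
Unset Strict Implicit.
Unset Printing Implicit Defensive.

Import Order.TTheory GRing.Theory Num.Theory.

Local Open Scope ring_scope.

(** * Weighted partial sums *)

Section WeightedSums.
Variable R : realType.
Implicit Types (w : nat -> R) (s t a b : seq R) (x y alpha mu : R).

Definition wsum w s : R := \sum_(0 <= i < size s) w i * s`_i.

Lemma wsum_cat w a b :
  wsum w (a ++ b) = wsum w a + wsum (fun i => w (size a + i)%N) b.
Proof.
rewrite /wsum size_cat (@big_cat_nat _ _ _ (size a)) //= ?leq_addr //.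
congr (_ + _).
  by apply: eq_big_nat => i /andP[_ lti]; rewrite nth_cat lti.
rewrite -{1}[size a]add0n big_addn addKn; apply: eq_bigr => i _.
by rewrite nth_cat ltnNge leq_addl /= addnK addnC.
Qed.

Lemma nth_rotC s i j : (i < size s)%N -> (j < size s)%N ->
  (rot i s)`_j = (rot j s)`_i.
Proof.
move=> lti ltj; rewrite /rot !nth_cat !size_drop !nth_drop !ltn_subRL (addnC j i).
case: ltnP => h //.
have -> : (i - (size s - j) = i + j - size s)%N by lia.
have -> : (j - (size s - i) = i + j - size s)%N by lia.
rewrite !nth_take; [by []|move: h lti ltj; move: (size s) => n; lia..].
Qed.

Lemma sum_wsum_rot w s :
  \sum_(0 <= i < size s) wsum w (rot i s) =
    (\sum_(0 <= i < size s) w i) * \sum_(x <- s) x.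
Proof.
rewrite /wsum (eq_bigr (fun i => \sum_(0 <= j < size s) w j * (rot i s)`_j));
  last by move=> i _; rewrite size_rot.
rewrite exchange_big_nat /= mulr_suml; apply: eq_big_nat => j /andP[_ ltj].
rewrite -mulr_sumr; congr (_ * _).
have p_rot : perm_eq s (rot j s) by rewrite perm_sym perm_rot.
rewrite (perm_big _ p_rot) /=.
rewrite [RHS](big_nth 0) size_rot; apply: eq_big_nat => i /andP[_ lti].
exact: nth_rotC.
Qed.

Lemma wsum_constant_eq w x s (C : R) :
  (forall t, perm_eq t (x :: s) -> wsum w t = C) -> w 0%N != w (size s) ->
  forall y, y \in s -> y = x.
Proof.
move=> wC w0 y ys; have p_ys := perm_to_rem ys.
have szr : (size (rem y s)).+1 = size s.
  by rewrite size_rem // prednK //; case: (s) ys.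
have wE u v : wsum w (u :: rcons (rem y s) v) =
    w 0%N * u + wsum (w \o S) (rem y s) + w (size s) * v.
  rewrite -cats1 -cat1s !wsum_cat /= {1}/wsum /= big_nat1.
  rewrite [X in _ + (_ + X)]/wsum /= big_nat1 /= addn0 add1n szr addrA.
  by congr (_ + _ + _).
have p1 : perm_eq (x :: rcons (rem y s) y) (x :: s).
  by rewrite perm_cons perm_rcons perm_sym.
have p2 : perm_eq (y :: rcons (rem y s) x) (x :: s).
  by rewrite -rcons_cons perm_rcons perm_cons perm_sym.
have := wC _ p1; rewrite -(wC _ p2) !wE => e.
have : (w 0%N - w (size s)) * (y - x) = 0 by lra.
by move/eqP; rewrite mulf_eq0 !subr_eq0 (negPf w0) => /eqP.
Qed.

Definition weight alpha (i : nat) : R :=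
  let k := Num.truncn alpha in
  if (i < k)%N then 1 else if i == k then alpha - k%:R else 0.

Lemma sum_weight_mul alpha (n : nat) (F : nat -> R) : 0 <= alpha <= n%:R ->
  let k := Num.truncn alpha in
  \sum_(0 <= i < n) weight alpha i * F i =
    \sum_(i < k) F i + (alpha - k%:R) * F k.
Proof.
move=> /andP[a0 an] k.
have /andP[ka ak] := truncn_itv a0.
have kn : (k <= n)%N by rewrite -(ler_nat R) (le_trans ka).
rewrite (@big_cat_nat _ _ _ k) //= big_mkord; congr (_ + _).
  by apply: eq_bigr => i _; rewrite /weight ltn_ord mul1r.
move: kn; rewrite leq_eqVlt => /predU1P[kn|kn].
  rewrite kn big_geq // -kn; apply/esym/eqP; rewrite mulf_eq0 subr_eq0.
  by rewrite eq_le ka {1}kn an.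
rewrite big_ltn // /weight ltnn eqxx big1_seq ?addr0 // => i /andP[_].
rewrite mem_index_iota => /andP[ki _].
by rewrite ltnNge ltnW //= gtn_eqF // mul0r.
Qed.

Lemma sum_weight alpha (n : nat) : 0 <= alpha <= n%:R ->
  \sum_(0 <= i < n) weight alpha i = alpha.
Proof.
move=> an; have := sum_weight_mul (fun=> 1) an.
rewrite /= sumr_const card_ord mulr1 addrC subrK => E; rewrite -[RHS]E.
by apply: eq_bigr => i _; rewrite mulr1.
Qed.

Lemma weight_eq1 alpha (i : nat) : i.+1%:R <= alpha -> weight alpha i = 1.
Proof.
by move=> ia; rewrite /weight ifT // truncn_ge_nat // (le_trans _ ia).
Qed.

Lemma weight_eq0 alpha (i : nat) : 0 <= alpha -> alpha < i%:R ->
  weight alpha i = 0.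
Proof.
move=> a0 ai; rewrite /weight.
have ki : (Num.truncn alpha < i)%N.
  by rewrite -(ltr_nat R) (le_lt_trans _ ai) // truncn_le.
by rewrite ltnNge ltnW //= gtn_eqF.
Qed.

Lemma weighted_blocks alpha mu (a b : seq R) x (p q : nat) :
    size a = p -> (size b).+1 = q -> (2 <= p)%N -> (p + 3 <= 2 * q)%N ->
    \sum_(y <- a) y = - (p%:R / 2%:R * mu) ->
    \sum_(y <- x :: b) y = q%:R * mu ->
    1 <= alpha <= (p + q)%:R ->
    (forall t, perm_eq t (a ++ x :: b) -> 0 <= wsum (weight alpha) t) ->
  [/\ 0 <= mu, alpha = 3%:R / 2%:R * p%:R -> x = mu &
      alpha < 3%:R / 2%:R * p%:R -> mu = 0 /\ x = 0].
Proof.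
move=> sa sb p2 pq Sa Sb /andP[a1 aN] H.
have a0 : 0 <= alpha by lra.
have p0 : (2 : R) <= p%:R by rewrite ler_nat.
have pq' : (p%:R + 3 : R) <= 2 * q%:R.
  by rewrite -!natrM -natrD ler_nat.
have sab : size (a ++ x :: b) = (p + q)%N by rewrite size_cat /= sa sb.
have full t : perm_eq t (a ++ x :: b) ->
    \sum_(0 <= i < p + q) wsum (weight alpha) (rot i t) =
      alpha * ((q%:R - p%:R / 2%:R) * mu).
  move=> pt; have st : size t = (p + q)%N by rewrite (perm_size pt).
  rewrite -st sum_wsum_rot st sum_weight ?a0 //; congr (_ * _).
  by rewrite (perm_big _ pt) big_cat /= Sa Sb; ring.
have mu0 : 0 <= mu.
  have : 0 <= alpha * ((q%:R - p%:R / 2%:R) * mu).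
    rewrite -(full _ (perm_refl _)) sumr_ge0 // => i _; apply: H.
    by rewrite perm_rot.
  by rewrite pmulr_rge0 ?pmulr_rge0 //; lra.
pose W1 := \sum_(0 <= i < p) weight alpha i.
pose W2 := \sum_(0 <= j < q) weight alpha (p + j).
have W12 : W1 + W2 = alpha.
  rewrite -[RHS](@sum_weight alpha (p + q)) ?a0 //.
  rewrite (@big_cat_nat _ _ _ p) //= ?leq_addr //; congr (_ + _).
  by rewrite -{1}[p]add0n big_addn addKn; apply: eq_bigr => j _; rewrite addnC.
have W2ge0 : 0 <= W2.
  rewrite sumr_ge0 // => j _; rewrite /weight.
  by case: ifP => // _; case: ifP => // _; rewrite subr_ge0 truncn_le.
have W1le : p%:R <= alpha -> W1 = p%:R.
  move=> pa; rewrite /W1 (eq_big_nat _ _ (F2 := fun=> 1)).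
    by rewrite big_const_nat subn0 iter_addr addr0.
  move=> i /andP[_ ip]; apply: weight_eq1.
  by rewrite (le_trans _ pa) // ler_nat.
have block b' : perm_eq b' (x :: b) ->
  \sum_(0 <= i < p) \sum_(0 <= j < q)
     wsum (weight alpha) (rot i a ++ rot j b') =
  p%:R * q%:R * mu * (W2 - W1 / 2%:R).
  move=> pb; have sb' : size b' = q by rewrite (perm_size pb).
  rewrite (eq_bigr (fun i => q%:R * wsum (weight alpha) (rot i a) +
     \sum_(0 <= j < q) wsum (fun l => weight alpha (p + l)) (rot j b'))); last first.
    move=> i _; under eq_bigr do rewrite wsum_cat size_rot sa.
    rewrite big_split /=; congr (_ + _).
    by rewrite big_const_nat subn0 iter_addr addr0 mulr_natl.
  have Ea := sum_wsum_rot (weight alpha) a.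
  have Eb := sum_wsum_rot (fun l => weight alpha (p + l)) b'.
  rewrite sa Sa -/W1 in Ea; rewrite sb' (perm_big _ pb) Sb -/W2 in Eb.
  rewrite big_split /= -mulr_sumr Ea Eb.
  by rewrite big_const_nat subn0 iter_addr addr0 -mulr_natl; field.
have cat_perm i j b' : perm_eq b' (x :: b) ->
    perm_eq (rot i a ++ rot j b') (a ++ x :: b).
  by move=> pb; rewrite perm_cat ?perm_rot.
split=> // [aE|alt].
  have W1E : W1 = p%:R by apply: W1le; lra.
  have Z b' : perm_eq b' (x :: b) -> wsum (weight alpha) (a ++ b') = 0.
    move=> pb; have := block _ pb.
    have -> : W2 - W1 / 2%:R = 0 by lra.
    rewrite mulr0 !big_mkord => /eqP; rewrite psumr_eq0; last first.
      by move=> i _; rewrite sumr_ge0 // => j _; apply/H/cat_perm.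
    move/allP=> Z; have pp : (0 < p)%N by lia.
    have /(_ (mem_index_enum _)) /= := Z (Ordinal pp).
    rewrite big_mkord psumr_eq0; last by move=> j _; apply/H/cat_perm.
    move/allP=> {}Z; have qq : (0 < q)%N by lia.
    by have /(_ (mem_index_enum _)) /= := Z (Ordinal qq); rewrite !rot0 => /eqP.
  have xE : forall y, y \in b -> y = x.
    apply: (@wsum_constant_eq (fun l => weight alpha (p + l))) => [t pt|].
      have := Z _ pt; rewrite wsum_cat sa => /eqP.
      by rewrite addrC addr_eq0 => /eqP ->; reflexivity.
    rewrite addn0 weight_eq1; last by rewrite aE -natr1; lra.
    rewrite weight_eq0 ?oner_eq0 // aE.
    have : (p + size b).+1%:R = p%:R + q%:R :> R by rewrite -natrD -sb addnS.
    by rewrite -natr1; lra.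
  move: Sb; rewrite (eq_big_seq (fun=> x)); last first.
    by move=> y; rewrite inE => /predU1P[|/xE].
  rewrite big_const_seq count_predT /= -iterS sb iter_addr addr0 -[x *+ q]mulr_natl.
  have q0 : (q%:R : R) != 0 by rewrite gt_eqF //; lra.
  by move/(mulfI q0).
have mu_eq0 : mu = 0.
  have : 0 <= p%:R * q%:R * mu * (W2 - W1 / 2%:R).
    rewrite -(block _ (perm_refl _)).
    by rewrite sumr_ge0 // => i _; rewrite sumr_ge0 // => j _; apply/H/cat_perm.
  have neg : W2 - W1 / 2%:R < 0.
    have [pa|ap] := leP p%:R alpha; first by rewrite W1le //; have := W1le pa; lra.
    have W2E : W2 = 0.
      rewrite /W2 big1_seq // => j _; rewrite weight_eq0 //.
      by rewrite (lt_le_trans ap) // ler_nat leq_addr.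
    lra.
  move=> ge0; apply/eqP; rewrite eq_le mu0 andbT leNgt; apply/negP => mugt.
  have : 0 < p%:R * q%:R * mu by rewrite !mulr_gt0 //; lra.
  nra.
split=> //.
have Z t : perm_eq t (a ++ x :: b) -> wsum (weight alpha) t = 0.
  move=> pt; have := full _ pt; rewrite mu_eq0 !mulr0 big_mkord => /eqP.
  rewrite psumr_eq0; last by move=> i _; apply: H; rewrite perm_rot.
  move/allP=> {}Z; have pp : (0 < p + q)%N by lia.
  by have /(_ (mem_index_enum _)) /= := Z (Ordinal pp); rewrite rot0 => /eqP.
have xE : forall y, y \in b ++ a -> y = x.
  apply: (@wsum_constant_eq (weight alpha)) => [t pt|].
    by apply: Z; rewrite perm_sym perm_catC perm_sym.
  rewrite weight_eq1 // weight_eq0 ?oner_eq0 // size_cat sa.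
  have : (size b + p).+1%:R = p%:R + q%:R :> R.
    by rewrite -natrD -sb addnS addnC.
  by rewrite -natr1; lra.
move: Sb; rewrite (eq_big_seq (fun=> x)); last first.
  by move=> y; rewrite inE => /predU1P[|yb] //; apply: xE; rewrite mem_cat yb.
rewrite big_const_seq count_predT /= -iterS sb iter_addr addr0 -[x *+ q]mulr_natl mu_eq0.
have q0 : (q%:R : R) != 0 by rewrite gt_eqF //; lra.
by rewrite mulr0 => /eqP; rewrite mulf_eq0 (negPf q0) => /eqP.
Qed.

End WeightedSums.

(** * Orthonormal families *)

Section Orthonormal.
Variables (R : realType) (W : vectType R) (f : W -> W -> R).
Hypothesis f_lin : forall a u v w, f (a *: u + v) w = a * f u w + f v w.
Hypothesis fC : forall u v, f u v = f v u.
Hypothesis f_gt0 : forall u, u != 0 -> 0 < f u u.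
Implicit Types (u v w : W) (s t : seq W) (U : {vspace W}).

Lemma form_sum (n : nat) (c : 'I_n -> R) (F : 'I_n -> W) w :
  f (\sum_i c i *: F i) w = \sum_i c i * f (F i) w.
Proof.
elim/big_rec2: _ => [|i y z _ <-]; last exact: f_lin.
by have := f_lin (-1) 0 0 w; rewrite scaleN1r oppr0 addr0 mulN1r addNr.
Qed.

Definition orthonormal_seq s := forall i j, (i < size s)%N -> (j < size s)%N ->
  f s`_i s`_j = (i == j)%:R.

Lemma orthonormal_expand s u : orthonormal_seq s -> u \in <<s>>%VS ->
  u = \sum_(x <- s) f u x *: x.
Proof.
move=> os us; have := @coord_span _ _ _ (in_tuple s) _ us => uE.
rewrite {1}uE (big_nth 0) big_mkord; apply: eq_bigr => j _; congr (_ *: _).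
rewrite {2}uE form_sum (bigD1 j) //= os // eqxx mulr1 big1 ?addr0 //.
by move=> i ij; rewrite os // (negPf ij : (val i == val j) = false) mulr0.
Qed.

Lemma orthonormal_seq_free s : orthonormal_seq s -> free s.
Proof.
move=> os; apply/(@freeP _ _ _ (in_tuple s)) => k k0 j.
have : f (\sum_i k i *: s`_i) s`_j = 0.
  rewrite k0; have := f_lin (-1) 0 0 s`_j.
  by rewrite scaleN1r oppr0 addr0 mulN1r addNr.
rewrite form_sum (bigD1 j) //= os // eqxx mulr1 big1 ?addr0 //.
by move=> i ij; rewrite os // (negPf ij : (val i == val j) = false) mulr0.
Qed.

Lemma orthonormal_rcons s w : orthonormal_seq s -> f w w = 1 ->
  (forall x, x \in s -> f w x = 0) -> orthonormal_seq (rcons s w).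
Proof.
move=> os w1 ws i j; rewrite size_rcons !ltnS !nth_rcons => li lj.
case: ltnP => hi; case: ltnP => hj.
- exact: os.
- have -> : j = size s by apply/eqP; rewrite eqn_leq lj.
  by rewrite eqxx fC ws ?mem_nth // ltn_eqF.
- have -> : i = size s by apply/eqP; rewrite eqn_leq li.
  by rewrite eqxx ws ?mem_nth // gtn_eqF.
have -> : i = size s by apply/eqP; rewrite eqn_leq li.
have -> : j = size s by apply/eqP; rewrite eqn_leq lj.
by rewrite !eqxx.
Qed.

Lemma orthonormal_extend s U : orthonormal_seq s -> (<<s>> <= U)%VS ->
  exists t, orthonormal_seq (s ++ t) /\ <<s ++ t>>%VS = U.
Proof.
have [k] := ubnP (\dim U - \dim <<s>>%VS).
elim: k s => // k IH s; rewrite ltnS => dk os sU.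
have [Us|/subvPn[u uU us]] := boolP (U <= <<s>>)%VS.
  by exists [::]; rewrite cats0; split=> //; apply/eqP; rewrite eqEsubv sU.
pose v := u - \sum_(x <- s) f u x *: x.
have sumS : \sum_(x <- s) f u x *: x \in <<s>>%VS.
  by rewrite big_seq rpred_sum // => x xs; rewrite rpredZ ?memv_span.
have vU : v \in U by rewrite rpredB // (subvP sU).
have vs : v \notin <<s>>%VS.
  apply: contra us => vs; rewrite -(subrK (\sum_(x <- s) f u x *: x) u).
  by rewrite rpredD.
have v0 : v != 0 by apply: contra vs => /eqP ->; rewrite mem0v.
have fvx x : x \in s -> f v x = 0.
  case/(nthP 0) => j lt_j <-.
  rewrite /v addrC -scaleN1r f_lin (big_nth 0) big_mkord form_sum.
  rewrite (bigD1 (Ordinal lt_j)) //= os // eqxx mulr1.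
  rewrite big1 ?addr0; first by rewrite mulN1r addNr.
  by move=> i ij; rewrite os // (negPf ij : (val i == j) = false) mulr0.
pose c := Num.sqrt (f v v); pose w := c^-1 *: v.
have c0 : 0 < c by rewrite sqrtr_gt0 f_gt0.
have fZ a y z : f (a *: y) z = a * f y z.
  have := f_lin a y 0 z; rewrite addr0 => ->.
  have := f_lin (-1) 0 0 z; rewrite scaleN1r oppr0 addr0 mulN1r addNr => ->.
  by rewrite addr0.
have w1 : f w w = 1.
  rewrite fZ fC fZ mulrA -[f v v]sqr_sqrtr ?ltW ?f_gt0 // -/c.
  by rewrite -expr2 -exprMn mulVf ?gt_eqF // expr1n.
have ws : w \notin <<s>>%VS.
  by apply: contra vs => ws; rewrite -(scalerKV (lt0r_neq0 c0) v) rpredZ.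
have os' : orthonormal_seq (rcons s w).
  by apply: orthonormal_rcons => // x xs; rewrite fZ fvx ?mulr0.
have sU' : (<<rcons s w>> <= U)%VS.
  apply/span_subvP => x; rewrite mem_rcons inE => /predU1P[->|xs].
    by rewrite rpredZ.
  by apply: (subvP sU); rewrite memv_span.
have dim_lt : (\dim <<s>> < \dim <<rcons s w>>)%N.
  have sub : (<<s>> <= <<rcons s w>>)%VS.
    by apply: sub_span => x xs; rewrite mem_rcons inE xs orbT.
  rewrite (ltn_leqif (dimv_leqif_sup sub)); apply: contra ws => /subvP; apply.
  by rewrite memv_span // mem_rcons mem_head.
have dimU := dimvS sU'.
have [t []] := IH (rcons s w) ltac:(lia) os' sU'.
by rewrite cat_rcons => ? ?; exists (w :: t).
Qed.

Lemma orthonormal_projection (P : {linear W -> W}) s :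
    (forall u, P (P u) = P u) -> (forall u v, f (P u) v = f u (P v)) ->
    orthonormal_seq s -> (forall x, x \in s -> P x = x) ->
  exists t, [/\ orthonormal_seq (s ++ t), forall x, x \in s ++ t -> P x = x &
    forall u, P u = \sum_(x <- s ++ t) f u x *: x].
Proof.
move=> PP Pf os Ps; pose U := lker (linfun P - \1%VF).
have UP x : (x \in U) = (P x == x).
  by rewrite memv_ker add_lfunE opp_lfunE lfunE id_lfunE subr_eq0.
have sU : (<<s>> <= U)%VS.
  by apply/span_subvP => x xs; rewrite UP Ps.
have [t [ot tU]] := orthonormal_extend os sU.
exists t; split=> // [x xt|u].
  by apply/eqP; rewrite -UP -tU memv_span.
rewrite [LHS](orthonormal_expand ot); last by rewrite tU UP PP.
rewrite !big_seq; apply: eq_bigr => x xt; congr (_ *: _).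
by rewrite Pf; congr f; apply/eqP; rewrite -UP -tU memv_span.
Qed.

End Orthonormal.

Section OrthonormalPerm.
Variables (R : realType) (W : vectType R) (f : W -> W -> R).
Implicit Types s t : seq W.

Lemma orthonormal_seq_uniqP s : orthonormal_seq f s <->
  uniq s /\ {in s &, forall x y, f x y = (x == y)%:R}.
Proof.
split=> [os|[us Hs] i j li lj]; last by rewrite Hs ?mem_nth // nth_uniq.
have us : uniq s.
  apply/(uniqP 0) => i j li lj eq_ij; apply/eqP.
  have := os i i li li; rewrite {2}eq_ij os // eqxx => /eqP.
  by case: (i == j); rewrite // eq_sym oner_eq0.
split=> // x y /(nthP 0)[i li <-] /(nthP 0)[j lj <-].
by rewrite os // nth_uniq.
Qed.

Lemma perm_orthonormal_seq s t : perm_eq s t ->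
  orthonormal_seq f t -> orthonormal_seq f s.
Proof.
move=> st /orthonormal_seq_uniqP[ut Ht]; apply/orthonormal_seq_uniqP.
split=> [|x y]; first by rewrite (perm_uniq st).
by rewrite !(perm_mem st); apply: Ht.
Qed.

Lemma cat_orthonormal_seq s t : orthonormal_seq f s -> orthonormal_seq f t ->
    (forall x y, x \in s -> y \in t -> f x y = 0 /\ f y x = 0) ->
  orthonormal_seq f (s ++ t).
Proof.
move=> os ot st i j; rewrite size_cat !nth_cat => hi hj.
have sub k : (k < size s + size t -> size s <= k -> k - size s < size t)%N.
  by move: (size s) (size t) => a b; lia.
case: ltnP => li; case: ltnP => lj.
- exact: os.
- have [-> _] := st _ _ (mem_nth 0 li) (mem_nth 0 (sub _ hj lj)).
  by rewrite ltn_eqF // (leq_trans li).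
- have [_ ->] := st _ _ (mem_nth 0 lj) (mem_nth 0 (sub _ hi li)).
  by rewrite gtn_eqF // (leq_trans lj).
by rewrite ot ?sub // -(eqn_add2l (size s)) !subnKC.
Qed.

End OrthonormalPerm.

Lemma perm_map_exists (T1 T2 : eqType) (f : T1 -> T2) (s : seq T1)
    (t : seq T2) :
  perm_eq t (map f s) -> exists2 s', perm_eq s' s & t = map f s'.
Proof.
case: s => [/perm_nilP ->|x s0]; first by exists [::].
move: (x :: s0) => {s0} s.
case/(perm_iotaP (f x)) => Is pIs ->; exists (map (nth x s) Is).
  apply: (perm_trans (perm_map _ pIs)).
  by rewrite size_map map_nth_iota0 ?take_size.
rewrite -map_comp; apply/eq_in_map => i iIs /=.
move: iIs; rewrite (perm_mem pIs) mem_iota size_map => /andP[_ li].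
by rewrite (nth_map x).
Qed.

(** * Projectors on matrices *)

Section QuadrupleSums.
Variables (R : realType) (n : nat).
Implicit Types F G r : 'I_n -> 'I_n -> 'I_n -> 'I_n -> R.

Definition sum4 F : R := \sum_i \sum_j \sum_k \sum_l F i j k l.

Lemma eq_sum4 F G : (forall i j k l, F i j k l = G i j k l) -> sum4 F = sum4 G.
Proof.
by move=> FG; do 4![apply: eq_bigr => ? _]; apply: FG.
Qed.

Lemma sum4D F G : sum4 (fun i j k l => F i j k l + G i j k l) = sum4 F + sum4 G.
Proof.
rewrite /sum4 -big_split; apply: eq_bigr => i _.
rewrite -big_split; apply: eq_bigr => j _.
by rewrite -big_split; apply: eq_bigr => k _; rewrite big_split.
Qed.

Lemma sum4Z a F : sum4 (fun i j k l => a * F i j k l) = a * sum4 F.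
Proof.
rewrite /sum4 mulr_sumr; apply: eq_bigr => i _.
rewrite mulr_sumr; apply: eq_bigr => j _.
by rewrite mulr_sumr; apply: eq_bigr => k _; rewrite mulr_sumr.
Qed.

Definition mx_second_kind r (A : 'M[R]_n) : R :=
  sum4 (fun i j k l => r i j k l * A i l * A j k).

End QuadrupleSums.

Section ComplexMatrices.
Variables (R : realType) (n : nat) (J : 'M[R]_n).
Hypotheses (J_skew : J^T = - J) (J_sqr : J *m J = - 1%:M) (n_gt0 : (0 < n)%N).
Implicit Types A B : 'M[R]_n.

Definition mxdot A B : R := \tr (A^T *m B).

Lemma mxdotE A B : mxdot A B = \sum_i \sum_j A i j * B i j.
Proof.
rewrite /mxdot /mxtrace exchange_big /=; apply: eq_bigr => i _.
by rewrite mxE; apply: eq_bigr => j _; rewrite mxE.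
Qed.

Lemma mxdot_lin a A B C : mxdot (a *: A + B) C = a * mxdot A C + mxdot B C.
Proof.
by rewrite /mxdot linearD linearZ /= mulmxDl mxtraceD -scalemxAl mxtraceZ.
Qed.

Lemma mxdotC A B : mxdot A B = mxdot B A.
Proof. by rewrite /mxdot -mxtrace_tr trmx_mul trmxK. Qed.

Lemma mxdotDl A B C : mxdot (A + B) C = mxdot A C + mxdot B C.
Proof. by rewrite -[A]scale1r mxdot_lin mul1r scale1r. Qed.

Lemma mxdotZl a A C : mxdot (a *: A) C = a * mxdot A C.
Proof. by rewrite /mxdot linearZ /= -scalemxAl mxtraceZ. Qed.

Lemma mxdotNl A C : mxdot (- A) C = - mxdot A C.
Proof. by rewrite -scaleN1r mxdotZl mulN1r. Qed.

Lemma mxdot_gt0 A : A != 0 -> 0 < mxdot A A.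
Proof.
move=> A0; have ge0 i : 0 <= \sum_j A i j * A i j.
  by rewrite sumr_ge0 // => j _; rewrite -expr2 sqr_ge0.
rewrite lt_def {2}mxdotE sumr_ge0 // andbT; apply: contra A0.
rewrite mxdotE => /eqP Z; apply/eqP/matrixP => i j; apply/eqP; rewrite mxE.
have /(_ i isT) Zi := psumr_eq0P (fun i _ => ge0 i) Z.
have /(_ j isT)/eqP := psumr_eq0P (fun j _ => sqr_ge0 (A i j)) Zi.
by rewrite mulf_eq0 orbb.
Qed.

(* Since J^T J = 1, a bilinear form A is J-invariant iff twist A = - A. *)
Definition twist A : 'M[R]_n := J *m A *m J.

Lemma twistD A B : twist (A + B) = twist A + twist B.
Proof. by rewrite /twist mulmxDr mulmxDl. Qed.

Lemma twistZ a A : twist (a *: A) = a *: twist A.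
Proof. by rewrite /twist -scalemxAr -scalemxAl. Qed.

Lemma twistN A : twist (- A) = - twist A.
Proof. by rewrite -scaleN1r twistZ scaleN1r. Qed.

Lemma twistK A : twist (twist A) = A.
Proof.
by rewrite /twist !mulmxA J_sqr -mulmxA J_sqr mulmxN mulmx1 !mulNmx mul1mx opprK.
Qed.

Lemma twist1 : twist 1%:M = - 1%:M.
Proof. by rewrite /twist mulmx1. Qed.

Lemma trmx_twist A : (twist A)^T = twist A^T.
Proof. by rewrite /twist !trmx_mul J_skew !(mulNmx, mulmxN) opprK mulmxA. Qed.

Lemma mxtrace_twist A : \tr (twist A) = - \tr A.
Proof. by rewrite /twist mxtrace_mulC mulmxA J_sqr mulNmx mul1mx raddfN. Qed.

Lemma mxdot_twist A B : mxdot (twist A) B = mxdot A (twist B).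
Proof.
by rewrite /mxdot trmx_twist /twist -!mulmxA mxtrace_mulC -!mulmxA.
Qed.

Lemma mxdot_tr A B : mxdot A^T B = mxdot A B^T.
Proof. by rewrite /mxdot trmxK mxtrace_mulC -mxtrace_tr trmx_mul. Qed.

Lemma mxdot1 A : mxdot A 1%:M = \tr A.
Proof. by rewrite /mxdot mulmx1 mxtrace_tr. Qed.

Lemma J_opp i j : J i j = - J j i.
Proof. by have /matrixP/(_ j i) := J_skew; rewrite !mxE. Qed.

Lemma twist_delta i l j k : twist (delta_mx i l) j k = J i j * J k l.
Proof.
rewrite mxE (bigD1 l) //= mxE (bigD1 i) //= mxE !eqxx mulr1.
rewrite !big1 ?addr0 ?(J_opp j) ?(J_opp l) ?mulrNN //.
  move=> b /negPf bl; rewrite mxE big1 ?mul0r // => a _.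
  by rewrite mxE bl andbF mulr0.
by move=> a /negPf ai; rewrite mxE ai mulr0.
Qed.

Definition anti_proj A := 4%:R^-1 *: (A + A^T + (twist A + twist A^T)).

Definition herm_proj A :=
  4%:R^-1 *: (A + A^T - (twist A + twist A^T)) - (\tr A / n%:R) *: 1%:M.

Lemma anti_proj_is_linear : linear anti_proj.
Proof.
move=> a A B; rewrite /anti_proj !linearP /= !twistD !twistZ.
move: (twist _) (twist _) (twist _) (twist _) => K1 K2 K3 K4.
by apply/matrixP => i j; rewrite !mxE; ring.
Qed.

Lemma herm_proj_is_linear : linear herm_proj.
Proof.
move=> a A B; rewrite /herm_proj !linearD /= !twistD !linearZ /= !twistZ.
move: (twist _) (twist _) (twist _) (twist _) => K1 K2 K3 K4.
by apply/matrixP => i j; rewrite !mxE; ring.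
Qed.

HB.instance Definition _ :=
  GRing.isLinear.Build R 'M[R]_n 'M[R]_n _ anti_proj anti_proj_is_linear.
HB.instance Definition _ :=
  GRing.isLinear.Build R 'M[R]_n 'M[R]_n _ herm_proj herm_proj_is_linear.

Lemma anti_proj_id A : A^T = A -> twist A = A -> anti_proj A = A.
Proof.
by move=> TA KA; rewrite /anti_proj TA KA; apply/matrixP => i j; rewrite !mxE; field.
Qed.

Lemma anti_proj_sym A : (anti_proj A)^T = anti_proj A.
Proof.
rewrite /anti_proj linearZ /= !linearD /= !trmx_twist trmxK.
move: (twist _) (twist _) => K1 K2.
by apply/matrixP => i j; rewrite !mxE; ring.
Qed.

Lemma twist_anti_proj A : twist (anti_proj A) = anti_proj A.
Proof. by rewrite /anti_proj twistZ !twistD !twistK [in RHS]addrC. Qed.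

Lemma mxtrace_anti A : twist A = A -> \tr A = 0.
Proof. by move=> KA; have := mxtrace_twist A; rewrite KA; lra. Qed.

Lemma anti_proj_adj A B : mxdot (anti_proj A) B = mxdot A (anti_proj B).
Proof.
rewrite /anti_proj mxdotZl (mxdotC A) mxdotZl !mxdotDl mxdot_tr !mxdot_twist.
rewrite mxdot_tr trmx_twist !(mxdotC _ A) (mxdotC B) (mxdotC B^T) !mxdot_twist.
by ring.
Qed.

Lemma herm_proj_id A : A^T = A -> twist A = - A -> \tr A = 0 ->
  herm_proj A = A.
Proof.
move=> TA KA trA; rewrite /herm_proj TA KA trA mul0r scale0r.
by apply/matrixP => i j; rewrite !mxE; field.
Qed.

Lemma herm_proj_sym A : (herm_proj A)^T = herm_proj A.
Proof.
rewrite /herm_proj linearB !linearZ /= linearB /= !linearD /= !trmx_twist trmxK.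
rewrite trmx1; move: (twist _) (twist _) => K1 K2.
by apply/matrixP => i j; rewrite !mxE; ring.
Qed.

Lemma twist_herm_proj A : twist (herm_proj A) = - herm_proj A.
Proof.
rewrite /herm_proj twistD twistN !twistZ twist1 twistD twistN !twistD !twistK.
move: (twist _) (twist _) => K1 K2.
by apply/matrixP => i j; rewrite !mxE; ring.
Qed.

Lemma mxtrace_herm_proj A : \tr (herm_proj A) = 0.
Proof.
have n0 : n%:R != 0 :> R by rewrite pnatr_eq0 -lt0n.
rewrite /herm_proj linearB !linearZ /= linearB /= !linearD /= !mxtrace_twist.
by rewrite mxtrace_tr mxtrace1; field.
Qed.

Lemma herm_proj_adj A B : mxdot (herm_proj A) B = mxdot A (herm_proj B).
Proof.
rewrite /herm_proj (mxdotC A) !(mxdotDl, mxdotNl, mxdotZl) mxdot_tr !mxdot_twist.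
rewrite mxdot_tr trmx_twist !(mxdotC _ A) (mxdotC B) (mxdotC B^T) !mxdot_twist.
by rewrite !(mxdotC 1%:M) !mxdot1; ring.
Qed.

Lemma mxdot_herm_anti A B : twist A = - A -> twist B = B -> mxdot A B = 0.
Proof.
move=> KA KB; have := mxdot_twist A B; rewrite KA KB.
by rewrite /mxdot linearN mulNmx raddfN /=; lra.
Qed.

Lemma herm_anti_proj A : A^T = A -> \tr A = 0 ->
  A = herm_proj A + anti_proj A.
Proof.
move=> TA trA; rewrite /herm_proj /anti_proj TA trA mul0r scale0r.
by move: (twist _) => K; apply/matrixP => i j; rewrite !mxE; field.
Qed.

Lemma anti_proj_delta (i j k l : 'I_n) : let I : 'M[R]_n := 1%:M in
  anti_proj (delta_mx i l) j k =
    4%:R^-1 * (I i j * I k l + I i k * I j l + (J i j * J k l + J i k * J j l)).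
Proof.
move: (twist_delta i l j k) (twist_delta l i j k); rewrite /anti_proj trmx_delta.
move: (twist _) (twist _) => K1 K2; rewrite !mxE => -> ->.
rewrite (J_opp l j) (J_opp k i) mulrNN !(eq_sym j) (eq_sym k i) -!mulnb !natrM.
by ring.
Qed.

Lemma herm_proj_delta (i j k l : 'I_n) : let I : 'M[R]_n := 1%:M in
  herm_proj (delta_mx i l) j k =
    4%:R^-1 * (I i j * I k l + I i k * I j l - (J i j * J k l + J i k * J j l))
    - n%:R^-1 * (I i l * I j k).
Proof.
have trE : \tr (delta_mx i l : 'M[R]_n) = (i == l)%:R.
  rewrite /mxtrace (bigD1 i) //= mxE eqxx /= big1 ?addr0 // => a /negPf ai.
  by rewrite mxE ai.
move: (twist_delta i l j k) (twist_delta l i j k); rewrite /herm_proj trmx_delta.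
move: (twist _) (twist _) => K1 K2; rewrite trE !mxE => -> ->.
rewrite (J_opp l j) (J_opp k i) mulrNN !(eq_sym j) (eq_sym k i) -!mulnb !natrM.
by ring.
Qed.

Section ProjectionBasis.
Variables (P : {linear 'M[R]_n -> 'M[R]_n}) (t : seq 'M[R]_n).
Hypothesis Pt : forall A, P A = \sum_(B <- t) mxdot A B *: B.

Lemma mxdot_delta i l A : mxdot (delta_mx i l) A = A i l.
Proof.
rewrite mxdotE (bigD1 i) //= (bigD1 l) //= mxE !eqxx mul1r.
rewrite !big1 ?addr0 // => [k /negPf ki|k /negPf kl].
  by rewrite big1 // => j _; rewrite mxE ki mul0r.
by rewrite mxE kl andbF mul0r.
Qed.

Lemma projection_kernel i j k l :
  P (delta_mx i l) j k = \sum_(B <- t) B i l * B j k.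
Proof.
by rewrite Pt summxE; apply: eq_bigr => B _; rewrite mxE mxdot_delta.
Qed.

Lemma projection_size : orthonormal_seq mxdot t ->
  (size t)%:R = \sum_i \sum_l P (delta_mx i l) i l.
Proof.
move=> ot; have -> : (size t)%:R = \sum_(B <- t) mxdot B B.
  rewrite (big_nth 0) big_mkord (eq_bigr (fun=> 1)); last first.
    by move=> i _; rewrite ot // eqxx.
  by rewrite sumr_const card_ord.
under eq_bigr do rewrite mxdotE.
rewrite exchange_big; apply: eq_bigr => i _ /=.
rewrite exchange_big; apply: eq_bigr => l _ /=.
by rewrite projection_kernel.
Qed.

Lemma projection_trace (r : 'I_n -> 'I_n -> 'I_n -> 'I_n -> R) :
  \sum_(B <- t) mx_second_kind r B =
    sum4 (fun i j k l => r i j k l * P (delta_mx i l) j k).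
Proof.
rewrite /mx_second_kind /sum4.
rewrite exchange_big; apply: eq_bigr => i _ /=.
rewrite exchange_big; apply: eq_bigr => j _ /=.
rewrite exchange_big; apply: eq_bigr => k _ /=.
rewrite exchange_big; apply: eq_bigr => l _ /=.
by rewrite projection_kernel mulr_sumr; apply: eq_bigr => B _; rewrite mulrA.
Qed.

End ProjectionBasis.

Lemma sum_J_sqr i : \sum_l J i l * J i l = 1.
Proof.
have /matrixP/(_ i i) := J_sqr; rewrite !mxE eqxx => E.
rewrite -[RHS]opprK -E -sumrN; apply: eq_bigr => l _.
by rewrite (J_opp l) mulrN opprK.
Qed.

Lemma sum_id_sqr (i : 'I_n) :
  \sum_l (1%:M : 'M[R]_n) i l * (1%:M : 'M[R]_n) i l = 1.
Proof.
rewrite (bigD1 i) //= mxE eqxx mulr1 big1 ?addr0 // => l li.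
by rewrite mxE eq_sym (negPf li) mul0r.
Qed.

Lemma anti_proj_dim (t : seq 'M[R]_n) : orthonormal_seq mxdot t ->
  (forall A, anti_proj A = \sum_(B <- t) mxdot A B *: B) ->
  4%:R * (size t)%:R = (n * (n + 2))%:R :> R.
Proof.
move=> ot Pt; rewrite (projection_size Pt ot) (eq_bigr (fun=> 4%:R^-1 * (n%:R + 2))).
  by rewrite sumr_const card_ord natrM natrD -[_ *+ n]mulr_natl; field.
have I1 a : (1%:M : 'M[R]_n) a a = 1 by rewrite mxE eqxx.
move=> i _; have J0 : J i i = 0 by have := J_opp i i; lra.
have -> : n%:R = \sum_(l < n) 1 :> R by rewrite sumr_const card_ord.
have -> : 2 = \sum_l (1%:M : 'M[R]_n) i l * (1%:M : 'M[R]_n) i l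
            + \sum_l J i l * J i l by rewrite sum_id_sqr sum_J_sqr; ring.
rewrite -!big_split mulr_sumr; apply: eq_bigr => l _.
rewrite anti_proj_delta /= J0 !I1; ring.
Qed.

Lemma herm_proj_dim (t : seq 'M[R]_n) : orthonormal_seq mxdot t ->
  (forall A, herm_proj A = \sum_(B <- t) mxdot A B *: B) ->
  4%:R * (size t)%:R = (n ^ 2)%:R - 4 :> R.
Proof.
move=> ot Pt; have n0 : n%:R != 0 :> R by rewrite pnatr_eq0 -lt0n.
rewrite (projection_size Pt ot) (eq_bigr (fun=> 4%:R^-1 * n%:R - n%:R^-1)).
  by rewrite sumr_const card_ord -[_ *+ n]mulr_natl natrX; field.
have I1 a : (1%:M : 'M[R]_n) a a = 1 by rewrite mxE eqxx.
move=> i _; have J0 : J i i = 0 by have := J_opp i i; lra.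
pose S1 := \sum_l (1%:M : 'M[R]_n) i l * (1%:M : 'M[R]_n) i l.
have -> : 4%:R^-1 * n%:R - n%:R^-1 = 4%:R^-1 * \sum_(l < n) (1 : R) +
    4%:R^-1 * S1 - 4%:R^-1 * \sum_l J i l * J i l - n%:R^-1 * S1.
  by rewrite /S1 sum_id_sqr sum_J_sqr sumr_const card_ord; ring.
rewrite !mulr_sumr -!sumrN -!big_split; apply: eq_bigr => l _.
rewrite herm_proj_delta /= J0 !I1; ring.
Qed.

End ComplexMatrices.

(** * Kaehler curvature *)

Section EuclideanSpace.
Variables (R : realType) (V : vectType R) (g : {dot V for idfun}).
Implicit Types X Y Z W : V.

Lemma dot_lin a X Y Z : g (a *: X + Y) Z = a * g X Z + g Y Z.
Proof. by rewrite linearDl linearZl. Qed.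

Lemma dotC X Y : g X Y = g Y X.
Proof. by rewrite hermC /= mul1r. Qed.

Lemma dotZl a X Y : g (a *: X) Y = a * g X Y.
Proof. by rewrite linearZl. Qed.

Lemma dot_gt0 X : X != 0 -> 0 < g X X.
Proof. exact: neq0_dnorm_gt0. Qed.

Lemma orthonormal_seqP (s : seq V) : orthonormal_seq g s -> orthonormal g s.
Proof.
move=> os; rewrite /orthonormal; apply/andP; split.
  by apply/allP => x /(nthP 0)[i li <-] /=; rewrite os // eqxx.
elim: s os => //= x s IH os; rewrite IH ?andbT; last first.
  by move=> i j li lj; apply: (os i.+1 j.+1).
by apply/allP => y /(nthP 0)[i li <-] /=; rewrite (os 0%N i.+1).
Qed.

Lemma orthonormal_basis_exists : exists e : (\dim {:V}).-tuple V,
  orthonormal_seq g e /\ orthonormal_basis g e.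
Proof.
have [//||e [oe eV]] := @orthonormal_extend _ _ g dot_lin dotC dot_gt0 [::] fullv.
  by rewrite subvf.
have fe := orthonormal_seq_free dot_lin oe.
have se : size e == \dim {:V} by rewrite -eV (eqP fe : \dim _ = _).
exists (Tuple se); split=> //; rewrite /orthonormal_basis orthonormal_seqP //.
by rewrite andbT /basis_of /= eV eqxx.
Qed.

Variables (e : (\dim {:V}).-tuple V).
Hypotheses (oe : orthonormal_seq g e) (be : basis_of {:V} e).
Local Notation n := (\dim {:V}).
Local Notation E := (tnth e).

Lemma dot_basis i j : g (E i) (E j) = (i == j)%:R.
Proof. by rewrite !(tnth_nth 0) oe ?size_tuple. Qed.

Lemma basis_expand X : X = \sum_i g X (E i) *: E i.
Proof.
have := orthonormal_expand dot_lin oe; move/(_ X).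
rewrite (span_basis be) memvf => /(_ isT) {1}->.
by rewrite big_tuple.
Qed.

Lemma parseval X Y : g X Y = \sum_i g X (E i) * g Y (E i).
Proof.
rewrite {1}(basis_expand X) (form_sum dot_lin).
by apply: eq_bigr => i _; rewrite (dotC Y).
Qed.

Lemma tensor2_ext (phi psi : tensor2 V) :
  (forall i j, phi (E i) (E j) = psi (E i) (E j)) -> phi = psi.
Proof.
move=> H; apply/lfunP => X; apply/lfunP => Y.
rewrite (basis_expand X) !linear_sum !sum_lfunE; apply: eq_bigr => i _.
rewrite !linearZ !scale_lfunE; congr (_ *: _).
rewrite (basis_expand Y) !linear_sum; apply: eq_bigr => j _.
by rewrite !linearZ /= H.
Qed.

Definition mx_tensor2 (A : 'M[R]_n) X Y : R :=
  \sum_i \sum_j A i j * g X (E i) * g Y (E j).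

Lemma mx_tensor2_linr A X a Y Z :
  mx_tensor2 A X (a *: Y + Z) = a * mx_tensor2 A X Y + mx_tensor2 A X Z.
Proof.
rewrite /mx_tensor2 mulr_sumr -big_split; apply: eq_bigr => i _ /=.
rewrite mulr_sumr -big_split; apply: eq_bigr => j _ /=.
by rewrite dot_lin; ring.
Qed.

Lemma mx_tensor2_linl A X a Y Z :
  mx_tensor2 A (a *: Y + Z) X = a * mx_tensor2 A Y X + mx_tensor2 A Z X.
Proof.
rewrite /mx_tensor2 mulr_sumr -big_split; apply: eq_bigr => i _ /=.
rewrite mulr_sumr -big_split; apply: eq_bigr => j _ /=.
by rewrite dot_lin; ring.
Qed.

Lemma mx_tensor2_linM a A B X Y :
  mx_tensor2 (a *: A + B) X Y = a * mx_tensor2 A X Y + mx_tensor2 B X Y.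
Proof.
rewrite /mx_tensor2 mulr_sumr -big_split; apply: eq_bigr => i _ /=.
rewrite mulr_sumr -big_split; apply: eq_bigr => j _ /=.
by rewrite !mxE; ring.
Qed.

HB.instance Definition _ A X :=
  GRing.isLinear.Build R V R^o _ (mx_tensor2 A X) (mx_tensor2_linr A X).

Definition mx_tensor1 A X : 'Hom(V, R^o) := linfun (mx_tensor2 A X : V -> R^o).

Lemma mx_tensor1_is_linear A : linear (mx_tensor1 A).
Proof.
move=> a X Y; apply/lfunP => Z; rewrite add_lfunE scale_lfunE !lfunE /=.
exact: mx_tensor2_linl.
Qed.

HB.instance Definition _ A :=
  GRing.isLinear.Build R V 'Hom(V, R^o) _ (mx_tensor1 A) (mx_tensor1_is_linear A).

Definition mx_tensor A : tensor2 V := linfun (mx_tensor1 A).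

Lemma mx_tensorE A X Y : mx_tensor A X Y = mx_tensor2 A X Y.
Proof. by rewrite !lfunE. Qed.

Lemma components_mx_tensor A : components e (mx_tensor A) = A.
Proof.
apply/matrixP => i j; rewrite mxE mx_tensorE /mx_tensor2.
rewrite (bigD1 i) //= (bigD1 j) //= !dot_basis !eqxx !mulr1.
rewrite !big1 ?addr0 // => [a ai|b bj].
  by rewrite big1 // => b _; rewrite dot_basis eq_sym (negPf ai) mulr0 mul0r.
by rewrite [g (E j) _]dot_basis eq_sym (negPf bj) mulr0.
Qed.

Lemma componentsK phi : mx_tensor (components e phi) = phi.
Proof.
apply: tensor2_ext => i j.
by have /matrixP/(_ i j) := components_mx_tensor (components e phi); rewrite !mxE.
Qed.

Lemma mx_tensor_lin a A B :
  mx_tensor (a *: A + B) = a *: mx_tensor A + mx_tensor B.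
Proof.
apply/lfunP => X; apply/lfunP => Y.
rewrite !add_lfunE !scale_lfunE !mx_tensorE; exact: mx_tensor2_linM.
Qed.

Lemma mx_tensor_traceless_symmetric A : A^T = A -> \tr A = 0 ->
  traceless_symmetric e (mx_tensor A).
Proof.
move=> TA trA; split=> [X Y|]; last by rewrite components_mx_tensor.
rewrite !mx_tensorE /mx_tensor2 exchange_big; apply: eq_bigr => j _ /=.
by apply: eq_bigr => i _; rewrite -{1}TA mxE; ring.
Qed.

Lemma traceless_symmetric_components phi : traceless_symmetric e phi ->
  (components e phi)^T = components e phi /\ \tr (components e phi) = 0.
Proof. by case=> sym tr0; split=> //; apply/matrixP => i j; rewrite !mxE sym. Qed.

Lemma mx_tensor_basis (s : seq 'M[R]_n) (sz : size s = dim_S20 V) :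
    orthonormal_seq (@mxdot R n) s ->
    (forall A, A \in s -> A^T = A /\ \tr A = 0) ->
    (forall A, A^T = A -> \tr A = 0 -> A \in <<s>>%VS) ->
  exists phi : (dim_S20 V).-tuple (tensor2 V),
    orthonormal_basis_S20 e phi /\ val phi = map mx_tensor s.
Proof.
move=> os sT s_span.
have szl : size (map mx_tensor s) == dim_S20 V by rewrite size_map sz.
have phiE (i : 'I_(dim_S20 V)) : tnth (Tuple szl) i = mx_tensor s`_i.
  by rewrite (tnth_nth 0) (nth_map 0) // sz.
exists (Tuple szl); split=> //; split.
- move=> i; rewrite phiE; have [] := sT s`_i; first by rewrite mem_nth // sz.
  exact: mx_tensor_traceless_symmetric.
- by move=> i j; rewrite /tensor_dot !phiE !components_mx_tensor [LHS]os // sz.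
move=> psi /traceless_symmetric_components[Tpsi trpsi].
rewrite -(componentsK psi) (@coord_span _ _ _ (in_tuple s) _ (s_span _ Tpsi trpsi)).
have -> : forall (k : nat) (c : 'I_k -> R) (F : 'I_k -> 'M[R]_n),
    mx_tensor (\sum_i c i *: F i) = \sum_i c i *: mx_tensor (F i).
  move=> k c F; elim/big_rec2: _ => [|i y z _ <-]; last by rewrite mx_tensor_lin.
  by have := mx_tensor_lin (-1) 0 0; rewrite scaleN1r oppr0 addr0 scaleN1r addNr.
rewrite rpred_sum // => i _; rewrite rpredZ // memv_span //=.
by rewrite map_f // mem_nth.
Qed.

End EuclideanSpace.

Section KahlerTraces.
Variables (R : realType) (V : vectType R) (g : {dot V for idfun}) (J : 'End(V)).
Variables (Rm : tensor4 V) (e : (\dim {:V}).-tuple V).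
Hypotheses (hJ : complex_euclidean g J) (hRm : kahler_curvature J Rm).
Hypotheses (oe : orthonormal_seq g e) (be : basis_of {:V} e).
Local Notation n := (\dim {:V}).
Local Notation E := (tnth e).

Definition curvature (X Y Z W : V) : R := Rm X Y Z W.
Local Notation curv := curvature.

Lemma curv_sum12 (c d : 'I_n -> R) Z W :
  curv (\sum_i c i *: E i) (\sum_j d j *: E j) Z W =
  \sum_i \sum_j c i * d j * curv (E i) (E j) Z W.
Proof.
rewrite /curvature (linear_sum Rm) !sum_lfunE; apply: eq_bigr => i _.
rewrite (linearZZ Rm) !scale_lfunE (linear_sum (Rm (E i))) !sum_lfunE scaler_sumr.
apply: eq_bigr => j _.
by rewrite (linearZZ (Rm (E i))) !scale_lfunE scalerA.
Qed.

Lemma curv_pair X Y Z W : curv X Y Z W = curv Z W X Y.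
Proof. by case: hRm => -[_ _ sym _] _; apply: sym. Qed.

Lemma curv_anti12 X Y Z W : curv X Y Z W = - curv Y X Z W.
Proof. by case: hRm => -[sym _ _ _] _; apply: sym. Qed.

Lemma curv_anti34 X Y Z W : curv X Y Z W = - curv X Y W Z.
Proof. by case: hRm => -[_ sym _ _] _; apply: sym. Qed.

Lemma curv_bianchi X Y Z W : curv X Y Z W + curv Y Z X W + curv Z X Y W = 0.
Proof. by case: hRm => -[_ _ _ sym] _; apply: sym. Qed.

Lemma curv_J34 X Y Z W : curv X Y (J Z) (J W) = curv X Y Z W.
Proof. by case: hRm => _ sym; symmetry; apply: sym. Qed.

Lemma JJ X : J (J X) = - X. Proof. by case: hJ. Qed.

Lemma dot_J X Y : g (J X) (J Y) = g X Y. Proof. by case: hJ. Qed.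

Lemma dot_J_skew X Y : g (J X) Y = - g X (J Y).
Proof. by rewrite -dot_J JJ linearNl. Qed.

Lemma curv_sum34 (c d : 'I_n -> R) X Y :
  curv X Y (\sum_i c i *: E i) (\sum_j d j *: E j) =
  \sum_i \sum_j c i * d j * curv X Y (E i) (E j).
Proof.
rewrite curv_pair curv_sum12; apply: eq_bigr => i _; apply: eq_bigr => j _.
by rewrite curv_pair.
Qed.

Lemma curv_sum24 (c d : 'I_n -> R) X Z :
  curv X (\sum_i c i *: E i) Z (\sum_j d j *: E j) =
  \sum_i \sum_j c i * d j * curv X (E i) Z (E j).
Proof.
rewrite /curvature (linear_sum (Rm X)) !sum_lfunE; apply: eq_bigr => i _.
rewrite (linearZZ (Rm X)) !scale_lfunE linear_sum scaler_sumr.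
by apply: eq_bigr => j _; rewrite linearZ scalerA.
Qed.

Lemma curv_sum1 (c : 'I_n -> R) (F : 'I_n -> V) Y Z W :
  curv (\sum_i c i *: F i) Y Z W = \sum_i c i * curv (F i) Y Z W.
Proof.
rewrite /curvature (linear_sum Rm) !sum_lfunE; apply: eq_bigr => i _.
by rewrite (linearZZ Rm) !scale_lfunE.
Qed.

Lemma curv_sum3 (c : 'I_n -> R) (F : 'I_n -> V) X Y W :
  curv X Y (\sum_i c i *: F i) W = \sum_i c i * curv X Y (F i) W.
Proof.
by rewrite curv_pair curv_sum1; apply: eq_bigr => i _; rewrite curv_pair.
Qed.

Definition curv_coef (i j k l : 'I_n) : R := curv (E i) (E j) (E k) (E l).

Lemma second_kind_curv (phi : tensor2 V) :
  second_kind e Rm phi phi = mx_second_kind curv_coef (components e phi).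
Proof. by []. Qed.

Section Contractions.
Variables (A B : 'M[R]_n) (a b : V -> V).
Hypothesis aE : forall i, a (E i) = \sum_k A i k *: E k.
Hypothesis bE : forall i, b (E i) = \sum_k B i k *: E k.

Lemma contract_ij_kl :
  sum4 (fun i j k l => curv_coef i j k l * (A i j * B k l)) =
  \sum_i \sum_k curv (E i) (a (E i)) (E k) (b (E k)).
Proof.
apply: eq_bigr => i _; rewrite exchange_big; apply: eq_bigr => k _ /=.
rewrite aE bE curv_sum24.
by apply: eq_bigr => j _; apply: eq_bigr => l _; rewrite mulrC.
Qed.

Lemma contract_ik_jl :
  sum4 (fun i j k l => curv_coef i j k l * (A i k * B j l)) =
  \sum_i \sum_j curv (E i) (E j) (a (E i)) (b (E j)).
Proof.
apply: eq_bigr => i _; apply: eq_bigr => j _; rewrite aE bE curv_sum34.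
by apply: eq_bigr => k _; apply: eq_bigr => l _; rewrite mulrC.
Qed.

Lemma contract_il_jk :
  sum4 (fun i j k l => curv_coef i j k l * (A i l * B j k)) =
  \sum_i \sum_j curv (E i) (E j) (b (E j)) (a (E i)).
Proof.
apply: eq_bigr => i _; apply: eq_bigr => j _; rewrite aE bE curv_sum34.
by apply: eq_bigr => k _; apply: eq_bigr => l _; rewrite mulrC [B _ _ * _]mulrC.
Qed.

End Contractions.

Definition Jmx : 'M[R]_n := \matrix_(i, k) g (J (E i)) (E k).

Lemma J_basis i : J (E i) = \sum_k Jmx i k *: E k.
Proof.
rewrite {1}(basis_expand oe be (J (E i))).
by apply: eq_bigr => k _; rewrite mxE.
Qed.

Lemma id_basis i : id (E i) = \sum_k (1%:M : 'M[R]_n) i k *: E k.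
Proof.
rewrite (bigD1 i) //= mxE eqxx scale1r big1 ?addr0 // => k ki.
by rewrite mxE eq_sym (negPf ki) scale0r.
Qed.

Lemma Jmx_skew : Jmx^T = - Jmx.
Proof. by apply/matrixP => i k; rewrite !mxE dot_J_skew dotC. Qed.

Lemma Jmx_sqr : Jmx *m Jmx = - 1%:M.
Proof.
apply/matrixP => i k; rewrite !mxE -(dot_basis oe) -linearNl -JJ /=.
rewrite [in RHS]dot_J_skew (parseval oe be) -sumrN.
apply: eq_bigr => l _; rewrite !mxE (dot_J_skew (E l)) (dotC g (E l)).
by rewrite mulrN.
Qed.

Definition scal : R := \sum_i \sum_j curv (E i) (E j) (E i) (E j).

Lemma sum_J_curv Y : \sum_i curv (J (E i)) Y (J (E i)) Y =
  \sum_i curv (E i) Y (E i) Y.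
Proof.
rewrite (eq_bigr (fun i => \sum_j Jmx i j * curv (J (E i)) Y (E j) Y)); last first.
  by move=> i _; rewrite [X in curv _ _ X]J_basis curv_sum3.
rewrite exchange_big; apply: eq_bigr => j _ /=.
rewrite -curv_sum1; congr (curv _ Y (E j) Y).
have -> : \sum_i Jmx i j *: J (E i) = - J (\sum_i Jmx j i *: E i).
  rewrite linear_sum -sumrN; apply: eq_bigr => i _.
  by rewrite linearZ /= -scaleNr !mxE dot_J_skew dotC.
by rewrite -J_basis JJ opprK.
Qed.

Lemma contract_J_ij_kl :
  \sum_i \sum_k curv (E i) (J (E i)) (E k) (J (E k)) = 2 * scal.
Proof.
have T i k : curv (E i) (J (E i)) (E k) (J (E k)) =
    curv (J (E i)) (E k) (J (E i)) (E k) + curv (E i) (E k) (E i) (E k).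
  have := curv_bianchi (E i) (J (E i)) (E k) (J (E k)).
  rewrite [curv (E k) (E i) _ _]curv_J34 [curv (E k) _ _ _]curv_anti12.
  rewrite -[curv (J (E i)) (E k) (E i) _]curv_J34 JJ.
  have -> : curv (J (E i)) (E k) (J (E i)) (- E k) =
    - curv (J (E i)) (E k) (J (E i)) (E k) by rewrite /curvature linearN.
  by lra.
under eq_bigr do under eq_bigr do rewrite T.
under eq_bigr do rewrite big_split.
rewrite big_split /= -/scal exchange_big /=.
under eq_bigr do rewrite sum_J_curv.
by rewrite exchange_big /= -/scal; ring.
Qed.

Lemma contract_J_ik_jl :
  \sum_i \sum_j curv (E i) (E j) (J (E i)) (J (E j)) = scal.
Proof. by do 2![apply: eq_bigr => ? _]; rewrite curv_J34. Qed.

Lemma contract_id_ij_kl : \sum_i \sum_k curv (E i) (E i) (E k) (E k) = 0.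
Proof.
apply: big1 => i _; apply: big1 => k _.
by have := curv_anti12 (E i) (E i) (E k) (E k); lra.
Qed.

Lemma contract_id_il_jk : \sum_i \sum_j curv (E i) (E j) (E j) (E i) = - scal.
Proof.
rewrite -sumrN; apply: eq_bigr => i _; rewrite -sumrN; apply: eq_bigr => j _.
exact: curv_anti34.
Qed.

Lemma trace_anti (t : seq 'M[R]_n) :
  (forall A, anti_proj Jmx A = \sum_(B <- t) mxdot A B *: B) ->
  \sum_(B <- t) mx_second_kind curv_coef B = scal.
Proof.
move=> Pt; rewrite (projection_trace Pt).
rewrite (eq_sum4 (G := fun i j k l => 4%:R^-1 *
  (curv_coef i j k l * (1%:M i j * 1%:M k l) +
   curv_coef i j k l * (1%:M i k * 1%:M j l) +
   (curv_coef i j k l * (Jmx i j * Jmx k l) +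
    curv_coef i j k l * (Jmx i k * Jmx j l))))); last first.
  by move=> i j k l; rewrite (anti_proj_delta Jmx_skew) /=; ring.
rewrite sum4Z !sum4D !(contract_ij_kl J_basis J_basis) !(contract_ik_jl J_basis J_basis).
rewrite !(contract_ij_kl id_basis id_basis) !(contract_ik_jl id_basis id_basis).
by rewrite contract_id_ij_kl contract_J_ij_kl contract_J_ik_jl -/scal; field.
Qed.

Lemma trace_herm (t : seq 'M[R]_n) :
  (forall A, herm_proj Jmx A = \sum_(B <- t) mxdot A B *: B) ->
  \sum_(B <- t) mx_second_kind curv_coef B = (n%:R^-1 - 2%:R^-1) * scal.
Proof.
move=> Pt; rewrite (projection_trace Pt).
rewrite (eq_sum4 (G := fun i j k l => 4%:R^-1 *
  (curv_coef i j k l * (1%:M i j * 1%:M k l) +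
   curv_coef i j k l * (1%:M i k * 1%:M j l) +
   (-1) * (curv_coef i j k l * (Jmx i j * Jmx k l) +
    curv_coef i j k l * (Jmx i k * Jmx j l))) +
   (- n%:R^-1) * (curv_coef i j k l * (1%:M i l * 1%:M j k)))); last first.
  by move=> i j k l; rewrite (herm_proj_delta Jmx_skew) /=; ring.
rewrite sum4D !sum4Z !sum4D sum4Z !sum4D.
rewrite !(contract_ij_kl J_basis J_basis) !(contract_ik_jl J_basis J_basis).
rewrite !(contract_ij_kl id_basis id_basis) !(contract_ik_jl id_basis id_basis).
rewrite (contract_il_jk id_basis id_basis) contract_id_il_jk.
rewrite contract_id_ij_kl contract_J_ij_kl contract_J_ik_jl -/scal.
by move: n%:R^-1 => c; field.
Qed.

Lemma sum4_curv (a b c d : 'I_n -> R) :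
  sum4 (fun i j k l => curv_coef i j k l * (a i * b j * c k * d l)) =
  curv (\sum_i a i *: E i) (\sum_i b i *: E i)
       (\sum_i c i *: E i) (\sum_i d i *: E i).
Proof.
rewrite curv_sum12; apply: eq_bigr => i _; apply: eq_bigr => j _.
rewrite curv_sum34 mulr_sumr; apply: eq_bigr => k _.
rewrite mulr_sumr; apply: eq_bigr => l _.
by rewrite /curv_coef; ring.
Qed.

(* The components of (X (x) X - JX (x) JX) / sqrt 2. *)
Definition holo_mx X : 'M[R]_n := (Num.sqrt 2)^-1 *:
  \matrix_(i, j) (g X (E i) * g X (E j) - g (J X) (E i) * g (J X) (E j)).

Lemma inv_sqrt2_sqr : (Num.sqrt 2)^-1 * (Num.sqrt 2)^-1 = 2^-1 :> R.
Proof. by rewrite -expr2 exprVn sqr_sqrtr // ler0n. Qed.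

Lemma holo_mx_second_kind X :
  mx_second_kind curv_coef (holo_mx X) = curv X (J X) X (J X).
Proof.
pose x i := g X (E i); pose y i := g (J X) (E i).
rewrite /mx_second_kind (eq_sum4 (G := fun i j k l => 2^-1 *
  (curv_coef i j k l * (x i * x j * x k * x l) +
   curv_coef i j k l * (y i * y j * y k * y l) +
   (-1) * (curv_coef i j k l * (x i * y j * y k * x l) +
           curv_coef i j k l * (y i * x j * x k * y l))))); last first.
  move=> i j k l; rewrite -inv_sqrt2_sqr !mxE -/(x _) -/(y _); ring.
rewrite sum4Z sum4D sum4Z !sum4D !sum4_curv /x /y.
rewrite -!(basis_expand oe be).
have XX : curv X X X X = 0 by have := curv_anti12 X X X X; lra.
have YY : curv (J X) (J X) (J X) (J X) = 0.
  by have := curv_anti12 (J X) (J X) (J X) (J X); lra.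
have := curv_anti34 X (J X) (J X) X; have := curv_anti12 (J X) X X (J X).
by rewrite XX YY; lra.
Qed.

Lemma dot_J_orth X : g X (J X) = 0.
Proof. by have := dot_J_skew X X; rewrite dotC; lra. Qed.

Lemma holo_mx_sym X : (holo_mx X)^T = holo_mx X.
Proof. by apply/matrixP => i j; rewrite !mxE; ring. Qed.

Lemma Jmx_act X i : \sum_k Jmx i k * g X (E k) = - g (J X) (E i).
Proof.
rewrite (eq_bigr (fun k => g (J (E i)) (E k) * g X (E k))); last first.
  by move=> k _; rewrite mxE.
by rewrite -(parseval oe be) dot_J_skew (dotC g (E i)).
Qed.

Lemma twist_holo_mx X : twist Jmx (holo_mx X) = holo_mx X.
Proof.
rewrite /holo_mx twistZ; congr (_ *: _).
pose x : 'cV[R]_n := \col_i g X (E i); pose y : 'cV[R]_n := \col_i g (J X) (E i).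
have -> : \matrix_(i, j) (g X (E i) * g X (E j) - g (J X) (E i) * g (J X) (E j))
    = x *m x^T - y *m y^T.
  by apply/matrixP => i j; rewrite !mxE !big_ord1 !mxE.
have Jx : Jmx *m x = - y.
  apply/matrixP => i j; rewrite !mxE -Jmx_act; apply: eq_bigr => k _.
  by rewrite !mxE.
have Jy : Jmx *m y = x.
  apply/matrixP => i j; rewrite !mxE.
  rewrite -[RHS]opprK -[X in - X]linearNl -JJ -Jmx_act.
  by apply: eq_bigr => k _; rewrite !mxE.
have xJ : x^T *m Jmx = y^T.
  by rewrite -[Jmx]trmxK -trmx_mul Jmx_skew mulNmx Jx opprK.
have yJ : y^T *m Jmx = - x^T.
  by rewrite -[Jmx]trmxK -trmx_mul Jmx_skew mulNmx Jy linearN.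
rewrite /twist mulmxBr mulmxBl !mulmxA Jx Jy -!mulmxA xJ yJ.
by rewrite mulNmx mulmxN opprK addrC.
Qed.

Lemma holo_mx_norm X : g X X = 1 -> mxdot (holo_mx X) (holo_mx X) = 1.
Proof.
move=> X1; pose x i := g X (E i); pose y i := g (J X) (E i).
have xx : \sum_i x i * x i = 1 by rewrite -(parseval oe be).
have yy : \sum_i y i * y i = 1 by rewrite -(parseval oe be) dot_J.
have xy : \sum_i x i * y i = 0 by rewrite -(parseval oe be) dot_J_orth.
rewrite mxdotE (eq_bigr (fun i => 2^-1 * (x i * x i + y i * y i))) => [|i _].
  by rewrite -mulr_sumr big_split /= xx yy; field.
have -> : 2^-1 * (x i * x i + y i * y i) =
    2^-1 * (x i * x i) * (\sum_j x j * x j) + 2^-1 * (y i * y i) *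
    (\sum_j y j * y j) - x i * y i * \sum_j x j * y j by rewrite xx yy xy; ring.
rewrite !mulr_sumr -sumrN -!big_split; apply: eq_bigr => j _ /=.
have -> : x i * y i * (x j * y j) = 2 * 2^-1 * (x i * y i * (x j * y j)).
  by field.
by rewrite -inv_sqrt2_sqr !mxE -/(x _) -/(y _); ring.
Qed.

End KahlerTraces.

Section Flat.
Variables (R : realType) (V : vectType R) (g : {dot V for idfun}) (J : 'End(V)).
Variables (Rm : tensor4 V).
Hypotheses (hJ : complex_euclidean g J) (hRm : kahler_curvature J Rm).
Local Notation curv := (curvature Rm).

Lemma curvD1 X X' Y Z W : curv (X + X') Y Z W = curv X Y Z W + curv X' Y Z W.
Proof. by rewrite /curvature linearD !add_lfunE. Qed.

Lemma curvD2 X Y Y' Z W : curv X (Y + Y') Z W = curv X Y Z W + curv X Y' Z W.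
Proof. by rewrite (curv_anti12 hRm) curvD1 opprD -!(curv_anti12 hRm). Qed.

Lemma curvD3 X Y Z Z' W : curv X Y (Z + Z') W = curv X Y Z W + curv X Y Z' W.
Proof. by rewrite (curv_pair hRm) curvD1 !(curv_pair hRm X). Qed.

Lemma curvD4 X Y Z W W' : curv X Y Z (W + W') = curv X Y Z W + curv X Y Z W'.
Proof. by rewrite (curv_anti34 hRm) curvD3 opprD -!(curv_anti34 hRm). Qed.

Lemma curvZ1 a X Y Z W : curv (a *: X) Y Z W = a * curv X Y Z W.
Proof. by rewrite /curvature (linearZZ Rm) !scale_lfunE. Qed.

Lemma curvN1 X Y Z W : curv (- X) Y Z W = - curv X Y Z W.
Proof. by rewrite -scaleN1r curvZ1 mulN1r. Qed.

Lemma curvN2 X Y Z W : curv X (- Y) Z W = - curv X Y Z W.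
Proof. by rewrite (curv_anti12 hRm) curvN1 -(curv_anti12 hRm). Qed.

Lemma curvN3 X Y Z W : curv X Y (- Z) W = - curv X Y Z W.
Proof. by rewrite (curv_pair hRm) curvN1 -(curv_pair hRm). Qed.

Lemma curvN4 X Y Z W : curv X Y Z (- W) = - curv X Y Z W.
Proof. by rewrite (curv_anti34 hRm) curvN3 -(curv_anti34 hRm). Qed.

Lemma curvZ2 a X Y Z W : curv X (a *: Y) Z W = a * curv X Y Z W.
Proof. by rewrite (curv_anti12 hRm) curvZ1 (curv_anti12 hRm X) mulrN. Qed.

Lemma curvZ3 a X Y Z W : curv X Y (a *: Z) W = a * curv X Y Z W.
Proof. by rewrite (curv_pair hRm) curvZ1 (curv_pair hRm X). Qed.

Lemma curvZ4 a X Y Z W : curv X Y Z (a *: W) = a * curv X Y Z W.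
Proof. by rewrite (curv_anti34 hRm) curvZ3 -mulrN -(curv_anti34 hRm). Qed.

Definition curvDN :=
   (curvD1, curvD2, curvD3, curvD4, curvN1, curvN2, curvN3, curvN4).

Lemma curv_J2 X Y Z W : curv X (J Y) Z W = curv Y (J X) Z W.
Proof.
by rewrite (curv_pair hRm) -(curv_J34 hRm) (JJ hJ) curvN4 -(curv_anti34 hRm)
  (curv_pair hRm).
Qed.

Lemma sectional_flat : (forall X Y, curv X Y X Y = 0) ->
  forall X Y Z W, curv X Y Z W = 0.
Proof.
move=> K0.
have K1 X Y W : curv X Y X W = 0.
  have := K0 X (Y + W); rewrite !curvDN !K0 (curv_pair hRm X W); lra.
have K2 X Y Z W : curv X Y Z W = - curv Z Y X W.
  by have := K1 (X + Z) Y W; rewrite !curvDN !K1; lra.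
move=> X Y Z W; have := curv_bianchi hRm X Y Z W.
have := K2 Y Z X W; have := curv_anti12 hRm X Z Y W; have := K2 Z X Y W.
have := curv_anti12 hRm Y X Z W; lra.
Qed.

Lemma holomorphic_flat : (forall X, curv X (J X) X (J X) = 0) ->
  forall X Y, curv X Y X Y = 0.
Proof.
move=> H0.
have H1 X Y : curv X (J X) Y (J Y) + 2 * curv X (J Y) X (J Y) = 0.
  have := H0 (X + Y); have := H0 (X - Y).
  rewrite !linearD !linearN !curvDN !H0 !(curv_J2 Y X).
  rewrite !(curv_pair hRm _ _ Y (J X)) !(curv_J2 Y X).
  rewrite (curv_pair hRm Y (J Y)); lra.
have H2 X Y : curv X Y X Y + 3 * curv X (J Y) X (J Y) = 0.
  have := H1 X Y; have := curv_bianchi hRm X (J X) Y (J Y).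
  rewrite (curv_J34 hRm Y X X Y).
  have := curv_anti12 hRm Y X X Y; have := curv_anti12 hRm (J X) Y X (J Y).
  have := curv_J2 Y X X (J Y); lra.
move=> X Y; have := H2 X Y; have := H2 X (J Y); rewrite (JJ hJ) !curvDN; lra.
Qed.

Lemma curvature_eq0 : (forall X Y Z W, curv X Y Z W = 0) -> Rm = 0.
Proof.
move=> K; apply/lfunP => X; apply/lfunP => Y; apply/lfunP => Z; apply/lfunP => W.
by rewrite !zero_lfunE; exact: K.
Qed.

Lemma kahler_flat : (forall X, g X X = 1 -> Rm X (J X) X (J X) = 0) ->
  forall X Y Z W, curv X Y Z W = 0.
Proof.
move=> H1.
have H0 X : curv X (J X) X (J X) = 0.
  have [->|X0] := eqVneq X 0; first
    by have := curvZ1 0 0 (J 0) 0 (J 0); rewrite scale0r mul0r.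
  pose c : R := Num.sqrt (g X X).
  have gX : 0 < g X X := dot_gt0 g X0.
  have c0 : c != 0 by rewrite gt_eqF // sqrtr_gt0.
  have cc : c * c = g X X by rewrite -expr2 sqr_sqrtr // ltW.
  have U1 : g (c^-1 *: X) (c^-1 *: X) = 1.
    by rewrite dotZl dotC dotZl -cc; field.
  have := H1 _ U1; rewrite -/(curvature Rm _ _ _ _) linearZ /= curvZ1 curvZ2 curvZ3 curvZ4.
  have ci : c^-1 != 0 by rewrite invr_eq0.
  by move/eqP; rewrite !mulf_eq0 (negPf ci) => /eqP.
exact: sectional_flat (holomorphic_flat H0).
Qed.

End Flat.

Section AlphaNonnegative.
Variables (R : realType) (V : vectType R) (m : nat).
Variables (g : {dot V for idfun}) (J : 'End(V)).
Hypotheses (hm : (2 <= m)%N) (hdim : \dim {:V} = (2 * m)%N).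
Hypothesis hJ : complex_euclidean g J.
Local Notation n := (\dim {:V}).

Lemma alpha_nonnegative_wsum (Rm : tensor4 V) (e : n.-tuple V) (alpha : R)
    (s : seq 'M[R]_n) (t : seq R) :
    alpha_nonnegative g alpha Rm ->
    orthonormal_seq g e -> basis_of {:V} e -> size s = dim_S20 V ->
    orthonormal_seq (@mxdot R n) s ->
    (forall A, A \in s -> A^T = A /\ \tr A = 0) ->
    (forall A, A^T = A -> \tr A = 0 -> A \in <<s>>%VS) ->
    perm_eq t (map (mx_second_kind (curv_coef Rm e)) s) ->
  0 <= wsum (weight alpha) t.
Proof.
move=> [alphaN pos] oe be sz os sT s_span /perm_map_exists[s' pss ->].
have os' := perm_orthonormal_seq pss os.
have sz' : size s' = dim_S20 V by rewrite (perm_size pss).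
have spanE : <<s'>>%VS = <<s>>%VS := eq_span (perm_mem pss).
have [phi [bphi phiE]] : exists phi : (dim_S20 V).-tuple (tensor2 V),
    orthonormal_basis_S20 e phi /\ val phi = map (mx_tensor g e) s'.
  apply: mx_tensor_basis => // [A|A TA trA]; last by rewrite spanE s_span.
  by rewrite (perm_mem pss); apply: sT.
have := pos e phi; rewrite /orthonormal_basis be orthonormal_seqP //.
move=> /(_ isT bphi) /=.
rewrite -(sum_weight_mul (fun i => second_kind e Rm phi`_i phi`_i) (n := dim_S20 V)).
  rewrite /wsum size_map sz'; congr (0 <= _); apply: eq_big_nat => i /andP[_ li].
  rewrite (nth_map 0) ?sz' // second_kind_curv phiE (nth_map 0) ?sz' //.
  by rewrite components_mx_tensor.
by case/andP: alphaN => a1 ->; rewrite (le_trans _ a1).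
Qed.

Theorem alpha_nonnegative_holomorphic (Rm : tensor4 V) (alpha : R) :
    kahler_curvature J Rm -> alpha_nonnegative g alpha Rm ->
  let alpha0 : R := 3%:R / 2%:R * (m%:R ^+ 2 - 1) in
  exists mu : R, forall X, g X X = 1 ->
    [/\ 0 <= mu, alpha = alpha0 -> Rm X (J X) X (J X) = mu &
        alpha < alpha0 -> Rm X (J X) X (J X) = 0].
Proof.
move=> hRm hpos alpha0.
have [e [oe be']] := orthonormal_basis_exists g.
have be : basis_of {:V} e by case/andP: be'.
have n0 : (0 < n)%N by rewrite hdim; lia.
pose Jm := Jmx g J e.
have Jskew : Jm^T = - Jm by exact: Jmx_skew.
have Jsqr : Jm *m Jm = - 1%:M by exact: Jmx_sqr.
have [||||ta [ota taP Pta]] := @orthonormal_projection _ _ (@mxdot R n)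
  (@mxdot_lin R n) (@mxdotC R n) (@mxdot_gt0 R n) (herm_proj Jm) [::].
- move=> A; apply: herm_proj_id; first exact: herm_proj_sym.
    exact: twist_herm_proj.
  exact: mxtrace_herm_proj.
- exact: herm_proj_adj.
- by [].
- by [].
rewrite cat0s in ota taP Pta.
exists (scal Rm e / (m * m.+1)%:R) => X X1.
pose M := holo_mx g J e X.
have oM : orthonormal_seq (@mxdot R n) [:: M].
  by move=> [|i] [|j] //= _ _; rewrite (holo_mx_norm hJ oe be X1).
have [||||tb [otb tbP Ptb]] := @orthonormal_projection _ _ (@mxdot R n)
  (@mxdot_lin R n) (@mxdotC R n) (@mxdot_gt0 R n) (anti_proj Jm) [:: M].
- move=> A; apply: anti_proj_id; first exact: anti_proj_sym.
  exact: twist_anti_proj.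
- exact: anti_proj_adj.
- by [].
- move=> x; rewrite inE => /eqP ->.
  exact: anti_proj_id (holo_mx_sym _ _ _ _) (twist_holo_mx hJ oe be X).
have nR : n%:R = 2 * m%:R :> R by rewrite hdim natrM.
have sza : (size ta).+1 = (m ^ 2)%N.
  apply/eqP; rewrite -(eqr_nat R) -natr1 natrX; apply/eqP.
  have := herm_proj_dim Jskew Jsqr n0 ota Pta; rewrite natrX nR => E.
  by move: E; move: (size ta)%:R => p E; lra.
have szb : (size tb).+1 = (m * m.+1)%N.
  apply/eqP; rewrite -(eqr_nat R) natrM -(natr1 m); apply/eqP.
  have := anti_proj_dim Jskew Jsqr otb Ptb.
  rewrite /= natrM natrD nR; move: (size tb).+1%:R => q E; lra.
have tra := trace_herm hJ hRm oe be Pta.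
have trb := trace_anti hJ hRm oe be Ptb.
have m0 : (2 : R) <= m%:R by rewrite ler_nat.
have mR0 : (m%:R : R) != 0 by rewrite gt_eqF //; lra.
have mR1 : (m%:R + 1 : R) != 0 by rewrite gt_eqF //; lra.
have qR : (m * m.+1)%:R = m%:R * (m%:R + 1) :> R by rewrite natrM -(natr1 m).
have pR : (m ^ 2).-1%:R = m%:R ^+ 2 - 1 :> R.
  by rewrite -sza /= -natrX -sza -natr1; ring.
pose f := mx_second_kind (curv_coef Rm e).
have sztab : dim_S20 V = ((m ^ 2).-1 + m * m.+1)%N.
  rewrite /dim_S20 hdim.
  have -> : ((2 * m).-1 * (2 * m).+2 = ((m ^ 2).-1 + m * m.+1) * 2)%N.
    by case: (m) hm => // k _; nia.
  by rewrite mulnK.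
have Hpos t : perm_eq t (map f ta ++ f M :: map f tb) ->
    0 <= wsum (weight alpha) t.
  rewrite -map_cons -map_cat => pt.
  apply: alpha_nonnegative_wsum pt => //.
  - by rewrite size_cat sztab /= szb -sza.
  - apply: cat_orthonormal_seq => // A B /taP AP /tbP BP.
    have KA : twist Jm A = - A by rewrite -AP twist_herm_proj.
    have KB : twist Jm B = B by rewrite -BP twist_anti_proj.
    by rewrite [mxdot B A]mxdotC (mxdot_herm_anti Jskew KA KB).
  - move=> A; rewrite mem_cat => /orP[/taP <-|/tbP <-]; split.
    + exact: herm_proj_sym.
    + exact: mxtrace_herm_proj.
    + exact: anti_proj_sym.
    exact/(mxtrace_anti Jsqr)/twist_anti_proj.
  move=> A TA trA; rewrite (herm_anti_proj Jm TA trA) span_cat Pta Ptb.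
  by rewrite memv_add // big_seq rpred_sum // => B Bt; rewrite rpredZ ?memv_span.
have [||||||||mu0 muE mu_lt] := @weighted_blocks R alpha (scal Rm e / (m * m.+1)%:R)
  (map f ta) (map f tb) (f M) (m ^ 2).-1 (m * m.+1).
- by rewrite size_map -sza.
- by rewrite size_map szb.
- nia.
- nia.
- rewrite big_map tra pR qR nR; by field; rewrite mR0 mR1.
- rewrite -map_cons big_map trb mulrC divfK // pnatr_eq0 muln_eq0; lia.
- by rewrite -sztab; case: hpos.
- exact: Hpos.
have HX : f M = Rm X (J X) X (J X) by exact: (holo_mx_second_kind hRm oe be).
rewrite pR -/alpha0 in muE mu_lt.
split=> [//|/muE <-|/mu_lt[_ <-]]; exact: esym HX.
Qed.

Lemma complex_unit_exists : exists X, g X X = 1.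
Proof.
have [e [oe _]] := orthonormal_basis_exists g.
have n0 : (0 < n)%N by rewrite hdim; lia.
by exists e`_0; rewrite oe // size_tuple.
Qed.

End AlphaNonnegative.

Lemma alpha_nonpositive_opp (R : realType) (V : vectType R)
    (g : {dot V for idfun}) (alpha : R) (Rm : tensor4 V) :
    alpha_nonpositive g alpha Rm ->
  exists2 Rm' : tensor4 V,
    forall X Y Z W, curvature Rm' X Y Z W = - curvature Rm X Y Z W &
    alpha_nonnegative g alpha Rm'.
Proof.
move=> H; eexists; last exact: H.
by move=> X Y Z W; rewrite /curvature !opp_lfunE.
Qed.

Lemma kahler_curvature_opp (R : realType) (V : vectType R) (J : 'End(V))
    (Rm Rm' : tensor4 V) :
    (forall X Y Z W, curvature Rm' X Y Z W = - curvature Rm X Y Z W) ->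
  kahler_curvature J Rm -> kahler_curvature J Rm'.
Proof.
move=> NE hRm.
have a12 X Y Z W : curvature Rm' X Y Z W = - curvature Rm' Y X Z W.
  by rewrite !NE; congr (- _); apply: curv_anti12 hRm _ _ _ _.
have a34 X Y Z W : curvature Rm' X Y Z W = - curvature Rm' X Y W Z.
  by rewrite !NE; congr (- _); apply: curv_anti34 hRm _ _ _ _.
have pair X Y Z W : curvature Rm' X Y Z W = curvature Rm' Z W X Y.
  by rewrite !NE; congr (- _); apply: curv_pair hRm _ _ _ _.
have bianchi X Y Z W :
    curvature Rm' X Y Z W + curvature Rm' Y Z X W + curvature Rm' Z X Y W = 0.
  by rewrite !NE -!opprD (curv_bianchi hRm) oppr0.
have J34 X Y Z W : curvature Rm' X Y Z W = curvature Rm' X Y (J Z) (J W).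
  by rewrite !NE (curv_J34 hRm).
by split; [split; [exact: a12|exact: a34|exact: pair|exact: bianchi]|exact: J34].
Qed.

Theorem proposition5p1 (R : realType) (V : vectType R) (m : nat)
    (g : {dot V for idfun}) (J : 'End(V)) (Rm : tensor4 V)
    (hm : (2 <= m)%N) (hdim : \dim {:V} = (2 * m)%N)
    (hJ : complex_euclidean g J) (hRm : kahler_curvature J Rm) :
  let alpha0 : R := 3%:R / 2%:R * (m%:R ^+ 2 - 1) in
  ((alpha_nonnegative g alpha0 Rm ->
      exists2 c : R, 0 <= c & constant_holomorphic_curvature g J Rm c) /\
   (alpha_nonpositive g alpha0 Rm ->
      exists2 c : R, c <= 0 & constant_holomorphic_curvature g J Rm c)) /\
  (forall alpha : R, alpha < alpha0 ->
     (alpha_nonnegative g alpha Rm -> Rm = 0) /\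
     (alpha_nonpositive g alpha Rm -> Rm = 0)).
Proof.
move=> alpha0.
have const Rm' : kahler_curvature J Rm' -> alpha_nonnegative g alpha0 Rm' ->
    exists2 c : R, 0 <= c & constant_holomorphic_curvature g J Rm' c.
  move=> hRm' /(alpha_nonnegative_holomorphic hm hdim hJ hRm')[mu H].
  have [U /H[mu0 _ _]] := complex_unit_exists g hm hdim.
  by exists mu => // X /H[_ -> //].
have flat Rm' alpha : alpha < alpha0 -> kahler_curvature J Rm' ->
    alpha_nonnegative g alpha Rm' ->
    forall X Y Z W, curvature Rm' X Y Z W = 0.
  move=> lt_alpha hRm' /(alpha_nonnegative_holomorphic hm hdim hJ hRm')[mu H].
  by apply: (kahler_flat hJ hRm') => X /H[_ _ ->].
split; [split=> [|/alpha_nonpositive_opp[RmN NE]]|]; first exact: const.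
  move=> /(const _ (kahler_curvature_opp NE hRm))[c c0 hc].
  exists (- c); first by rewrite oppr_le0.
  move=> X /hc E; have NX : c = - curvature Rm X (J X) X (J X) by rewrite -NE.
  by rewrite NX opprK.
move=> alpha lt_alpha; split=> [/(flat _ _ lt_alpha hRm)|].
  exact: curvature_eq0.
move=> /alpha_nonpositive_opp[RmN NE].
move=> /(flat _ _ lt_alpha (kahler_curvature_opp NE hRm)) N0.
by apply: curvature_eq0 => X Y Z W; apply: oppr_inj; rewrite -NE N0 oppr0.
Qed.
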